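(* Let $f:\mathbb{R}^D\to\mathbb{R}$ be continuous with effective dimension $d_e$, $d_e<D$ and $d_e\le d$, with effective subspace $\mathcal{T}$ and constant subspace $\mathcal{T}^\perp$ spanned by the columns of the orthonormal matrices $U\in\mathbb{R}^{D\times d_e}$ and $V\in\mathbb{R}^{D\times(D-d_e)}$, respectively. Assume that there is a global minimizer $\boldsymbol{x}^*$ of $f$ over $\mathcal{X}=[-1,1]^D$ whose associated set $G^*$ is non-degenerate, and that $f$ is Lipschitz continuous on $\mathbb{R}^D$ with constant $L$, i.e. $|f(\boldsymbol{x})-f(\boldsymbol{y})|\le L\|\boldsymbol{x}-\boldsymbol{y}\|_2$ for all $\boldsymbol{x},\boldsymbol{y}\in\mathbb{R}^D$. Let $A$ be a $D\times d$ Gaussian matrix and $\epsilon>0$ an accuracy tolerance. Then there exists a constant $\tau_\epsilon>0$ such that, for all $\boldsymbol{p}\in\mathcal{X}$, $$\mathbb{P}[(\mathrm{RP}\mathcal{X})\text{ is }\epsilon\text{-successful}]\ge\tau_\epsilon.$$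
   Context: A function $f:\mathbb{R}^D\to\mathbb{R}$ has effective dimension $d_e$ if there is a linear subspace $\mathcal{T}$ of dimension $d_e$ such that $f(\boldsymbol{x}_\top+\boldsymbol{x}_\perp)=f(\boldsymbol{x}_\top)$ for all $\boldsymbol{x}_\top\in\mathcal{T}$ and $\boldsymbol{x}_\perp\in\mathcal{T}^\perp$, and $d_e$ is the smallest integer with this property. $\mathcal{T}$ and $\mathcal{T}^\perp$ are called the effective and constant subspaces of $f$. For $\boldsymbol{x}\in\mathbb{R}^D$, $\boldsymbol{x}_\top=UU^T\boldsymbol{x}$. A Gaussian matrix is a random matrix with independent $\mathcal{N}(0,1)$ entries. For a global minimizer $\boldsymbol{x}^*$ of $f$ over $\mathcal{X}$, let $G^*:=\{\boldsymbol{x}\in\mathcal{X}:\boldsymbol{x}\in\boldsymbol{x}^*_\top+\mathcal{T}^\perp\}$ and $\bar G^*:=\{\boldsymbol{g}\in\mathbb{R}^{D-d_e}:\boldsymbol{x}^*_\top+V\boldsymbol{g}\in G^*\}$. $G^*$ is non-degenerate if $\mathrm{Vol}(\bar G^* )>0$ (Lebesgue volume in $\mathbb{R}^{D-d_e}$). Let $f^*=\min_{\boldsymbol{x}\in\mathcal{X}}f(\boldsymbol{x})$. The reduced problem $(\mathrm{RP}\mathcal{X})$ is: minimize $f(A\boldsymbol{y}+\boldsymbol{p})$ over $\boldsymbol{y}\in\mathbb{R}^d$ subject to $A\boldsymbol{y}+\boldsymbol{p}\in\mathcal{X}$. It is $\epsilon$-successful if there exists $\boldsymbol{y}^*\in\mathbb{R}^d$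 with $f(A\boldsymbol{y}^*+\boldsymbol{p})\le f^*+\epsilon$ and $A\boldsymbol{y}^*+\boldsymbol{p}\in\mathcal{X}$. *)

(* Defs.v *)
From HB Require Import structures.
From mathcomp Require Import all_boot all_order all_algebra.
From mathcomp Require Import all_classical all_reals all_analysis.

Set Implicit Arguments.
Unset Strict Implicit.
Unset Printing Implicit Defensive.

Import Order.TTheory GRing.Theory Num.Theory.
Import numFieldNormedType.Exports.

Local Open Scope classical_set_scope.
Local Open Scope ring_scope.

Definition dot (R : realType) (n : nat) (x y : 'cV[R]_n) : R :=
  \sum_(i < n) x i 0 * y i 0.

(* The norm `|x| that the library puts on matrices is the sup norm. *)
Definition norm2 (R : realType) (n : nat) (x : 'cV[R]_n) : R :=
  Num.sqrt (\sum_(i < n) x i 0 ^+ 2).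

Definition orthc (R : realType) (D : nat) (T : {vspace 'cV[R]_D}) :
    set 'cV[R]_D :=
  [set x | forall t, t \in T -> dot t x = 0].

Definition colspan (R : realType) (m n : nat) (M : 'M[R]_(m, n)) :
    {vspace 'cV[R]_m} :=
  <<[seq col j M | j : 'I_n]>>%VS.

Definition orthonormal_cols (R : realType) (m n : nat) (M : 'M[R]_(m, n)) :
    Prop :=
  M^T *m M = 1%:M.

Definition constant_off (R : realType) (D : nat) (f : 'cV[R]_D -> R)
    (T : {vspace 'cV[R]_D}) : Prop :=
  forall xt xp, xt \in T -> orthc T xp -> f (xt + xp) = f xt.

Definition has_effective_dim (R : realType) (D : nat) (f : 'cV[R]_D -> R)
    (de : nat) : Prop :=
  (exists T : {vspace 'cV[R]_D}, \dim T = de /\ constant_off f T) /\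
  (forall k : nat,
     (exists T : {vspace 'cV[R]_D}, \dim T = k /\ constant_off f T) ->
     (de <= k)%N).

Definition effective_subspace (R : realType) (D : nat) (f : 'cV[R]_D -> R)
    (de : nat) (T : {vspace 'cV[R]_D}) : Prop :=
  [/\ has_effective_dim f de, \dim T = de & constant_off f T].

Definition cube (R : realType) (D : nat) : set 'cV[R]_D :=
  [set x | forall i, -1 <= x i 0 <= 1].
Arguments cube : clear implicits.

Definition global_minimizer (R : realType) (D : nat) (f : 'cV[R]_D -> R)
    (X : set 'cV[R]_D) (x : 'cV[R]_D) : Prop :=
  X x /\ forall z, X z -> f x <= f z.

Definition is_minimum (R : realType) (D : nat) (f : 'cV[R]_D -> R)
    (X : set 'cV[R]_D) (m : R) : Prop :=
  (f @` X) m /\ lbound (f @` X) m.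

Definition box (R : realType) (n : nat) (a b : 'cV[R]_n) : set 'cV[R]_n :=
  [set x | forall i, a i 0 <= x i 0 <= b i 0].

(* The n-dimensional Lebesgue outer measure, n > 0: infimum of the total volume
   over countable covers by closed boxes (degenerate ones allowed). On Lebesgue
   measurable sets this is the Lebesgue measure.  For n = 0 the value on a
   nonempty set is +oo. *)
Definition vol (R : realType) (n : nat) (E : set 'cV[R]_n) : \bar R :=
  ereal_inf [set v | exists a b : nat -> 'cV[R]_n,
    [/\ forall k i, a k i 0 <= b k i 0,
        E `<=` \bigcup_k box (a k) (b k) &
        v = (\sum_(0 <= k <oo) (\prod_(i < n) (b k i 0 - a k i 0))%:E)%E]].

Definition proj_eff (R : realType) (D de : nat) (U : 'M[R]_(D, de))
    (x : 'cV[R]_D) : 'cV[R]_D :=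
  U *m U^T *m x.

Definition Gstar (R : realType) (D de : nat) (X : set 'cV[R]_D)
    (T : {vspace 'cV[R]_D}) (U : 'M[R]_(D, de)) (xstar : 'cV[R]_D) :
    set 'cV[R]_D :=
  [set x | X x /\ exists2 z, orthc T z & x = proj_eff U xstar + z].

Definition Gbar (R : realType) (D de m : nat) (X : set 'cV[R]_D)
    (T : {vspace 'cV[R]_D}) (U : 'M[R]_(D, de)) (V : 'M[R]_(D, m))
    (xstar : 'cV[R]_D) : set 'cV[R]_m :=
  [set g | Gstar X T U xstar (proj_eff U xstar + V *m g)].

Definition Gstar_nondegenerate (R : realType) (D de m : nat) (X : set 'cV[R]_D)
    (T : {vspace 'cV[R]_D}) (U : 'M[R]_(D, de)) (V : 'M[R]_(D, m))
    (xstar : 'cV[R]_D) : Prop :=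
  (0 < vol (Gbar X T U V xstar))%E.

Definition RP_successful (R : realType) (D d : nat) (f : 'cV[R]_D -> R)
    (X : set 'cV[R]_D) (fstar eps : R) (A : 'M[R]_(D, d)) (p : 'cV[R]_D) :
    Prop :=
  exists y : 'cV[R]_d, f (A *m y + p) <= fstar + eps /\ X (A *m y + p).

Definition mutually_independent (R : realType) (disp : measure_display)
    (Omega : measurableType disp) (P : probability Omega R) (I : finType)
    (Y : I -> {RV P >-> R}) : Prop :=
  forall (J : {set I}) (B : I -> set R), (forall i, measurable (B i)) ->
    P (\bigcap_(i in [set` J]) (Y i @^-1` B i)) =
    (\prod_(i in J) P (Y i @^-1` B i))%E.

(* The laws are compared on measurable sets only: both set functions take
   unspecified values elsewhere. *)
Definition gaussian_matrix (R : realType) (disp : measure_display)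
    (Omega : measurableType disp) (P : probability Omega R) (D d : nat)
    (A : 'I_D -> 'I_d -> {RV P >-> R}) : Prop :=
  (forall i j (B : set R), measurable B ->
     distribution P (A i j) B = normal_prob 0 1 B) /\
  mutually_independent (fun ij : 'I_D * 'I_d => A ij.1 ij.2).

Definition matrix_at (R : realType) (disp : measure_display)
    (Omega : measurableType disp) (P : probability Omega R) (D d : nat)
    (A : 'I_D -> 'I_d -> {RV P >-> R}) (w : Omega) : 'M[R]_(D, d) :=
  \matrix_(i, j) A i j w.

(* Main.v *)
(* Let x* be a minimizer. By continuity of f, some point x1 = (1 - t) x* is the
   centre of a ball contained in the cube on which f <= f* + eps. If d > 0, a
   matrix A whose first column lies close to x1 - p satisfies A e_1 + p near x1,
   so the problem succeeds; as the entries of x1 - p are bounded by 2, the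
   Gaussian density on the corresponding intervals is bounded below uniformly
   in p, and independence gives tau. If d = 0, then de = 0 and f is constant.
   The success event is measurable because it is the preimage of an F_sigma:
   for y in a compact box the set of matrices A with A y + p in a closed set
   projects to a closed set. *)
Require Import Defs.
From HB Require Import structures.
From mathcomp Require Import all_boot all_order all_algebra.
From mathcomp Require Import all_classical all_reals all_analysis.
From mathcomp Require Import measurable_realfun.

Set Implicit Arguments.
Unset Strict Implicit.
Unset Printing Implicit Defensive.

Import Order.TTheory GRing.Theory Num.Theory.
Import numFieldNormedType.Exports.

Local Open Scope classical_set_scope.
Local Open Scope ring_scope.

(** Matrix neighbourhoods are generated by products of entrywise ones, and a filter is stable under
    the finitely many intersections involved. *)
Lemma cvg_mx (R : realType) (m n : nat) (I : Type) (F : set_system I)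
    (FF : Filter F) (g : I -> 'M[R]_(m, n)) (M : 'M[R]_(m, n)) :
  (forall i j, g x i j @[x --> F] --> M i j) -> g x @[x --> F] --> M.
Proof.
move=> gM A [B MB BA].
suff : \forall x \near F, forall i j, B i j (g x i j).
  by apply: filterS => x gx; exact: BA.
by apply: filter_forall => i; apply: filter_forall => j; exact: gM (MB i j).
Qed.

(** An open set of matrices is a countable union of open boxes with rational endpoints, and each box
    pulls back to a finite intersection of events on single entries. *)
Lemma measurable_open_mx_preimage (R : realType) (disp : measure_display)
    (Omega : measurableType disp) (P : probability Omega R) (m n : nat)
    (A : 'I_m -> 'I_n -> {RV P >-> R}) (O : set 'M[R]_(m, n)) :
  open O -> measurable [set w | O (matrix_at A w)].
Proof.
move=> oO.
pose rbox (q : 'M[rat * rat]_(m, n)) : set 'M[R]_(m, n) :=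
  [set M | forall i j, M i j \in `](ratr (q i j).1), (ratr (q i j).2)[].
(* Boxes that leave [O] contribute the empty set, so the union can run over the whole countable type
   of rational boxes. *)
pose F q : set Omega :=
  if `[< rbox q `<=` O >] then [set w | rbox q (matrix_at A w)] else set0.
have -> : [set w | O (matrix_at A w)] = \bigcup_q F q.
  apply/seteqP; split=> [w Ow|w [q _]]; last first.
    by rewrite /F; case: asboolP => // qO /= wq; exact: qO.
  have /nbhs_ballP[e /= e0 eO] := open_nbhs_nbhs (conj oO Ow).
  have ex i j : exists q : rat * rat,
      (matrix_at A w i j \in `](ratr q.1), (ratr q.2)[) /\
      forall z : R, z \in `](ratr q.1), (ratr q.2)[ ->
        ball (matrix_at A w i j) e z.
    set c := matrix_at A w i j.
    have [|a] := @rat_in_itvoo R (c - e) c; first by rewrite ltrBlDr ltrDl.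
    rewrite in_itv/= => /andP[a1 a2].
    have [|b] := @rat_in_itvoo R c (c + e); first by rewrite ltrDl.
    rewrite in_itv/= => /andP[b1 b2].
    exists (a, b); split; first by rewrite in_itv/= a2 b1.
    move=> z; rewrite in_itv/= => /andP[az zb].
    rewrite -ball_normE /ball_/= ltr_distlC.
    by rewrite (lt_trans a1 az) (lt_trans zb b2).
  pose q : 'M[rat * rat]_(m, n) := \matrix_(i, j) sval (cid (ex i j)).
  exists q => //; rewrite /F; case: asboolP => [_ i j|].
    by rewrite [q i j]mxE; case: cid => /= ? [].
  case=> M qM; apply: eO; split=> // i j.
  move: (qM i j); rewrite /q mxE; case: cid => /= r [_]; exact.
apply: countable_bigcupT_measurable => // q; rewrite /F.
case: asboolP => // _.
have -> : [set w | rbox q (matrix_at A w)] =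
    \bigcap_(ij in [set: 'I_m * 'I_n]) A ij.1 ij.2 @^-1`
      `](ratr (q ij.1 ij.2).1), (ratr (q ij.1 ij.2).2)[%classic.
  apply/seteqP; split=> [w wq [i j] _ /=|w wq i j].
    by move: (wq i j); rewrite mxE.
  by have := wq (i, j) I; rewrite mxE.
apply: fin_bigcap_measurable => [|[i j] _]; first exact: finite_finset.
by apply: measurable_funPTI.
Qed.

Lemma mulmx_tr_cvg (R : realType) (m n : nat) (M : 'M[R]_(m, n))
    (y : 'rV[R]_n) (p : 'cV[R]_m) :
  z.2 *m z.1^T + p @[z --> (y, M)] --> M *m y^T + p.
Proof.
apply: cvg_mx => i j; rewrite [X in _ --> X]mxE.
under eq_cvg do rewrite mxE.
apply: cvgD; last exact: cvg_cst.
rewrite mxE; under eq_cvg do rewrite mxE.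
apply: cvg_big => [|k _]; first exact: add_continuous.
rewrite mxE; under eq_cvg do rewrite mxE.
apply: cvgM.
- by apply: (cvg_comp _ (fun N : 'M[R]_(m, n) => N i k) cvg_snd); exact: coord_continuous.
- by apply: (cvg_comp _ (fun N : 'rV[R]_n => N j k) cvg_fst); exact: coord_continuous.
Qed.

(** This is the tube lemma: if no [y] in [K] works for [M], compactness yields one neighbourhood of
    [M] on which none works. Rows replace columns to match [rV_compact]. *)
Lemma closed_mulmx_proj (R : realType) (m n : nat) (K : set 'rV[R]_n)
    (C : set 'cV[R]_m) (p : 'cV[R]_m) :
  compact K -> closed C ->
  closed [set M : 'M[R]_(m, n) | exists2 y, K y & C (M *m y^T + p)].
Proof.
move=> /compact_near_coveringP cK cC; rewrite -openC openE => M /= nM.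
have KM y : K y -> \forall y' \near y & M' \near M, (~` C) (M' *m y'^T + p).
  move=> Ky; have nC : (~` C) (M *m y^T + p) by move=> CM; apply: nM; exists y.
  have /open_nbhs_nbhs := conj (closed_openC cC) nC.
  exact: mulmx_tr_cvg.
have := cK _ _ (fun M' y' => (~` C) (M' *m y'^T + p)) (nbhs_filter M) KM.
by apply: (@filterS _ (nbhs M)) => M' KC [y /KC].
Qed.

Lemma measurable_exists_mulmx (R : realType) (disp : measure_display)
    (Omega : measurableType disp) (P : probability Omega R) (m n : nat)
    (A : 'I_m -> 'I_n -> {RV P >-> R}) (C : set 'cV[R]_m) (p : 'cV[R]_m) :
  closed C -> measurable [set w | exists y, C (matrix_at A w *m y + p)].
Proof.
move=> cC.
pose K (k : nat) := [set y : 'rV[R]_n | forall i, `[- k%:R, k%:R]%classic (y ord0 i)].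
have -> : [set w | exists y, C (matrix_at A w *m y + p)] = \bigcup_k
    [set w | exists2 y, K k y & C (matrix_at A w *m y^T + p)].
  apply/seteqP; split=> [w [y Cy]|w [k _ [y _ Cy]]]; last by exists y^T.
  (* The matrix norm is the sup norm, so an integer above it bounds every coordinate of [y]. *)
  exists (Num.bound `|y^T|) => //; exists y^T; last by rewrite trmxK.
  move=> i; rewrite /= in_itv/= -ler_norml.
  apply: le_trans (ltW (archi_boundP (normr_ge0 _))).
  by rewrite [leRHS]mx_normrE (le_bigmax _ (fun ij => `|y^T ij.1 ij.2|) (ord0, i)).
apply: bigcupT_measurable => k.
have cK : compact (K k).
  apply: (@rV_compact R n (fun=> `[- k%:R, k%:R]%classic)) => i.
  exact: segment_compact.
have := measurable_open_mx_preimage A (closed_openC (closed_mulmx_proj (p := p) cK cC)).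
by move=> /measurableC; congr measurable; apply/seteqP; split=> w /=;
  rewrite notK.
Qed.

(** Every point of the ball has absolute value at most [b], and the standard normal density
    decreases in absolute value; the ball has length [r *+ 2]. *)
Lemma normal_prob_ball_ge (R : realType) (c r b : R) :
  0 <= r -> `|c| + r <= b ->
  ((normal_pdf 0 1 b * (r *+ 2))%:E <= normal_prob 0 1 (ball c r))%E.
Proof.
move=> r0 crb.
have mB := measurable_ball c r.
rewrite EFinM -(lebesgue_measure_ball c r0) -integral_cst //.
apply: ge0_le_integral => //.
- by move=> x _; rewrite lee_fin normal_pdf_ge0.
- apply/measurable_EFinP; apply: measurable_funTS.
  exact: measurable_normal_pdf.
move=> x; rewrite -ball_normE /ball_/= => /ltW cxr; rewrite lee_fin.
rewrite normal_pdfE ?oner_eq0// ler_wpM2l ?normal_peak_ge0//.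
rewrite /normal_fun ler_expR !subr0 !mulNr lerN2 ler_pM2r; last first.
  by rewrite invr_gt0 mulrn_wgt0// exprn_gt0.
rewrite -(real_normK (num_real x)) lerXn2r ?nnegrE//.
  by rewrite (le_trans _ crb)// addr_ge0.
apply: le_trans crb; rewrite -[x](subrKC c) (le_trans (ler_normD _ _))//.
by rewrite lerD2l distrC.
Qed.

Lemma prode_ge_expr (R : realType) (I : finType) (J : {set I}) (c : R)
    (F : I -> \bar R) :
  0 <= c -> (forall i, c%:E <= F i)%E ->
  ((c ^+ #|J|)%:E <= \prod_(i in J) F i)%E.
Proof.
move=> c0 cF; rewrite -prodr_const.
(* Nonnegativity of the partial products is carried through the induction, since multiplying the
   inequalities requires it. *)
suff [] : 0 <= \prod_(i in J) c /\
    ((\prod_(i in J) c)%:E <= \prod_(i in J) F i)%E by [].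
apply: (big_rec2 (fun a b => 0 <= a /\ (a%:E <= b)%E)) => // i x y _ [x0 xy].
by rewrite mulr_ge0// EFinM lee_pmul.
Qed.

(** The point [x] may lie on the boundary of the cube. Scaling it by [1 - t] leaves a margin [t] to
    each face and moves each coordinate by at most [t], so the sup-norm ball of radius [t] around
    the new point stays within [2t] of [x]. *)
Lemma near_minimizer_interior (R : realType) (D : nat) (f : 'cV[R]_D -> R)
    (x : 'cV[R]_D) (c : R) :
  {for x, continuous f} -> cube R D x -> f x < c ->
  exists (x1 : 'cV[R]_D) (r : R), [/\ 0 < r, cube R D x1 &
    forall z : 'cV[R]_D, (forall i, ball (x1 i 0) r (z i 0)) -> cube R D z /\ f z <= c].
Proof.
move=> fx xcube fxc.
have /nbhs_ballP[e /= e0 eP] : \forall z \near x, f z < c.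
  by move/cvgr_lt : fx; exact.
(* The bound [e / 2] gives [2t <= e]; the bound 1 keeps the factor [1 - t] nonnegative. *)
pose t := Num.min (e / 2) 1.
have t0 : 0 < t by rewrite lt_min divr_gt0//= ltr01.
have t1 : t <= 1 by rewrite ge_min lexx orbT.
have te : t * 2 <= e by rewrite -ler_pdivlMr// ge_min lexx.
have xi i : `|x i 0| <= 1 by rewrite ler_norml.
have x1i i : `|((1 - t) *: x) i 0| <= 1 - t.
  by rewrite mxE normrM ger0_norm ?subr_ge0// ler_piMr ?subr_ge0.
exists ((1 - t) *: x), t; split=> //.
  by move=> i; rewrite -ler_norml (le_trans (x1i i))// lerBlDr lerDl ltW.
move=> z; rewrite -ball_normE /ball_/= => zt; split.
  move=> i; rewrite -ler_norml.
  rewrite -(subrK (((1 - t) *: x) i 0) (z i 0)) (le_trans (ler_normD _ _))//.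
  by rewrite -[leRHS](subrKC t) lerD// distrC ltW.
apply/ltW/eP; split=> // i j; rewrite (ord1 j) -ball_normE /ball_/=.
rewrite -(subrK (((1 - t) *: x) i 0) (x i 0)) -addrA.
rewrite (le_lt_trans (ler_normD _ _))// (lt_le_trans _ te)// mulr_natr mulr2n.
rewrite ler_ltD//.
rewrite mxE -{1}[x i 0]mul1r -mulrBl opprB addrCA subrr addr0.
by rewrite normrM gtr0_norm// ler_piMr// ltW.
Qed.

Lemma closed_cube (R : realType) (D : nat) : closed (cube R D).
Proof.
have -> : cube R D = \bigcap_(i in [set: 'I_D])
    (fun x : 'cV[R]_D => x i 0) @^-1` `[-1, 1]%classic.
  apply/seteqP; split=> [x xc i _|x xc i]; first by rewrite /= in_itv/= xc.
  by have /= := xc i I; rewrite in_itv.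
apply: closed_bigI => i _; apply: preimage_closed; last exact: interval_closed.
by move=> x _; exact: coord_continuous.
Qed.

Lemma measurable_RP_successful (R : realType) (disp : measure_display)
    (Omega : measurableType disp) (P : probability Omega R) (D d : nat)
    (f : 'cV[R]_D -> R) (A : 'I_D -> 'I_d -> {RV P >-> R}) (m eps : R)
    (p : 'cV[R]_D) :
  continuous f ->
  measurable [set w | RP_successful f (cube R D) m eps (matrix_at A w) p].
Proof.
move=> fc.
apply: (@measurable_exists_mulmx _ _ _ _ _ _ A
  ([set z | f z <= m + eps] `&` cube R D)).
apply: closedI; last exact: closed_cube.
by apply: (@preimage_closed _ _ f [set z | z <= m + eps]);
  [move=> x _; exact: fc|exact: closed_le].
Qed.

Lemma constant_off_dim0 (R : realType) (D : nat) (f : 'cV[R]_D -> R)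
    (T : {vspace 'cV[R]_D}) :
  \dim T = 0%N -> constant_off f T -> forall x, f x = f 0.
Proof.
move=> /eqP; rewrite dimv_eq0 => /eqP -> fT x.
(* Every [x] is orthogonal to the zero subspace, so [f (0 + x) = f 0]. *)
rewrite -[x]add0r fT ?mem0v// => t; rewrite memv0 => /eqP ->.
by rewrite /dot big1// => i _; rewrite mxE mul0r.
Qed.

(** The event constrains only the [D] entries of column [j], so independence turns its probability
    into a product of [D] one-dimensional ball probabilities. *)
Lemma gaussian_column_near_ge (R : realType) (disp : measure_display)
    (Omega : measurableType disp) (P : probability Omega R) (D d : nat)
    (A : 'I_D -> 'I_d -> {RV P >-> R}) (j : 'I_d) (v : 'cV[R]_D) (r b : R) :
  gaussian_matrix A -> 0 <= r -> (forall i, `|v i 0| + r <= b) ->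
  let E := [set w | forall i, ball (v i 0) r (matrix_at A w i j)] in
  measurable E /\
  (((normal_pdf 0 1 b * (r *+ 2)) ^+ D)%:E <= P E)%E.
Proof.
move=> [Anormal Aindep] r0 vb E.
pose J := [set ij : 'I_D * 'I_d | ij.2 == j]%SET.
pose B (ij : 'I_D * 'I_d) : set R := ball (v ij.1 0) r.
have mB ij : measurable (B ij) by exact: measurable_ball.
have EB : E = \bigcap_(ij in [set` J]) (A ij.1 ij.2 @^-1` B ij).
  apply/seteqP; split=> [w Ew [i k]|w Bw i].
    by rewrite /= inE/= => /eqP ->; have := Ew i; rewrite mxE.
  by rewrite mxE; apply: (Bw (i, j)); rewrite /= inE/=.
have cardJ : #|J| = D.
  have -> : J = [set (i, j) | i : 'I_D]%SET.
    apply/setP => -[i k]; rewrite inE/=; apply/eqP/imsetP => [->|[i' _ [_ ->]]//].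
    by exists i.
  by rewrite card_imset ?card_ord// => i i' [].
split.
  rewrite EB; apply: fin_bigcap_measurable => [|ij _]; first exact: finite_finset.
  exact: measurable_funPTI.
rewrite EB Aindep// -[X in _ ^+ X]cardJ; apply: prode_ge_expr => [|ij].
  by rewrite mulr_ge0 ?normal_pdf_ge0 ?mulrn_wge0.
rewrite [leRHS](Anormal ij.1 ij.2 _ (mB ij)).
exact: normal_prob_ball_ge.
Qed.

Theorem theorem3p15 (R : realType) (D d de : nat)
  (f : 'cV[R]_D -> R) (T : {vspace 'cV[R]_D})
  (U : 'M[R]_(D, de)) (V : 'M[R]_(D, D - de)) (L fstar : R)
  (disp : measure_display) (Omega : measurableType disp)
  (P : probability Omega R) (A : 'I_D -> 'I_d -> {RV P >-> R}) (eps : R)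
  (hcont : continuous f)
  (hdeD : (de < D)%N) (hded : (de <= d)%N)
  (hT : effective_subspace f de T)
  (hU : orthonormal_cols U) (hUT : colspan U = T)
  (hV : orthonormal_cols V) (hVT : [set` colspan V] = orthc T)
  (hmin : exists xstar : 'cV[R]_D,
     global_minimizer f (cube R D) xstar /\
     Gstar_nondegenerate (cube R D) T U V xstar)
  (hfstar : is_minimum f (cube R D) fstar)
  (hLip : forall x y : 'cV[R]_D, `|f x - f y| <= L * norm2 (x - y))
  (hA : gaussian_matrix A)
  (heps : 0 < eps) :
  exists2 tau : R, 0 < tau &
    forall p : 'cV[R]_D, cube R D p ->
      (tau%:E <=
       P [set w | RP_successful f (cube R D) fstar eps
                           (matrix_at A w) p])%E.
Proof.
have [[x cx fx] _] := hfstar.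
case: d A hded hA => [|d] A hded hA.
  (* Without columns, [A y + p] is [p] itself, which is feasible, and [f] is constant because
     [de = 0]: success is certain. *)
  exists 1 => // p cp; rewrite [X in P X](_ : _ = setT) ?probability_setT//.
  rewrite -subTset => w _; exists 0; rewrite mulmx0 add0r; split=> //.
  have [_ dimT /constant_off_dim0 fT] := hT.
  have {}fT : forall z, f z = f 0.
    by apply: fT; rewrite dimT; apply/eqP; rewrite -leqn0.
  by rewrite fT -(fT x) fx lerDl ltW.
have fxc : f x < fstar + eps by rewrite fx ltrDl.
have [x1 [r [r0 cx1 x1P]]] := near_minimizer_interior (hcont x) cx fxc.
(* Entries of [x1 - p] are at most 2 in absolute value for every [p] in the cube, so [2 + r] serves
   all [p] at once. *)
exists ((normal_pdf 0 1 (2 + r) * (r *+ 2)) ^+ D) => [|p cp].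
  rewrite exprn_gt0// mulr_gt0 ?mulrn_wgt0// normal_pdfE ?oner_eq0//.
  by rewrite mulr_gt0 ?expR_gt0 ?normal_peak_gt0 ?oner_eq0.
have vb i : `|(x1 - p) i 0| + r <= 2 + r.
  rewrite lerD2r !mxE (le_trans (ler_normB _ _))// -[2]/(1 + 1) lerD//.
    by rewrite ler_norml cx1.
  by rewrite ler_norml cp.
have [mE PE] := gaussian_column_near_ge ord0 hA (ltW r0) vb.
apply: le_trans PE _; apply: le_measure; rewrite ?inE//.
  exact: measurable_RP_successful.
(* The first basis vector selects the first column, and that column is near [x1 - p] exactly when
   its sum with [p] is near [x1]. *)
move=> w Aw; exists (delta_mx ord0 0).
apply/and_comm/x1P => i; have := Aw i.
rewrite -colE -!ball_normE /ball_/= !mxE; congr (`|_| < r).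
by rewrite -addrA -opprD [p i 0 + _]addrC.
Qed.
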